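(* Let $n\ge 2$, let $G$ be a group of order $v$ whose elements are listed as $g_1,\ldots,g_v$, let $D\subseteq G$ be a $(v,k,\lambda)$ difference set in $G$, and let $C(i_1,\ldots,i_n)=[g_{i_1}\cdots g_{i_n}\in D]$ be the associated difference cube. Then the autotopy group $\mathrm{Atop}(C)$ contains a subgroup isomorphic to a semidirect product $(G^{n-1})\rtimes \mathrm{Mult}(D)$, where $G^{n-1}=G\times\cdots\times G$ ($n-1$ factors).
   Context: A $(v,k,\lambda)$ difference set in a group $G$ of order $v$ is a $k$-subset $D\subseteq G$ such that every non-identity $g\in G$ can be written as $d_1^{-1}d_2$ with $d_1,d_2\in D$ in exactly $\lambda$ ways. $[P]$ is $1$ if $P$ holds and $0$ otherwise. An $n$-cube of order $v$ is a function $C:\{1,\ldots,v\}^n\to\{0,1\}$. The group $(S_v)^n$ acts on $n$-cubes by $C^\alpha(i_1,\ldots,i_n)=C(\alpha_1^{-1}(i_1),\ldots,\alpha_n^{-1}(i_n))$ for $\alpha=(\alpha_1,\ldots,\alpha_n)$; the autotopy group $\mathrm{Atop}(C)$ is the stabiliser of $C$ under this action. A multiplier of $D$ is a group automorphism $\varphi$ of $G$ such that $\varphi(D)=aD$ for some $a\in G$; the multipliers form a subgroup $\mathrm{Mult}(D)\le\mathrm{Aut}(G)$. *)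

(* Defs.v *)
From mathcomp Require Import all_boot all_fingroup.

Set Implicit Arguments.
Unset Strict Implicit.
Unset Printing Implicit Defensive.

Local Open Scope group_scope.

(* The finite group G is the whole type gT. *)
Definition is_difference_set (gT : finGroupType) (v k lambda : nat)
    (D : {set gT}) : Prop :=
  [/\ #|gT| = v,
      #|D| = k
    & forall x : gT, x != 1 ->
        #|[set d in setX D D | d.1^-1 * d.2 == x]| = lambda].

Section Multipliers.

Variables (gT : finGroupType) (D : {set gT}).

Definition mult_set : {set {perm gT}} :=
  [set phi in Aut [set: gT] | [exists a : gT, phi @: D == a *: D]].

Lemma mult_setP (phi : {perm gT}) :
  reflect (phi \in Aut [set: gT] /\ exists a : gT, phi @: D = a *: D)
          (phi \in mult_set).
Proof.
rewrite [X in reflect _ X]inE; apply: (iffP andP) => -[Aphi].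
  by case/existsP=> a /eqP; split=> //; exists a.
by case=> a phiD; split=> //; apply/existsP; exists a; apply/eqP.
Qed.

Lemma mult_group_set : group_set mult_set.
Proof.
apply/group_setP; split.
  apply/mult_setP; split; first exact: group1.
  exists 1; rewrite mul1g -[RHS]imset_id.
  by apply: eq_imset => x; rewrite perm1.
move=> phi psi /mult_setP[Aphi [a phiD]] /mult_setP[Apsi [b psiD]].
apply/mult_setP; split; first exact: groupM.
exists (psi a * b).
have psiM x y : psi (x * y) = psi x * psi y.
  by move/Aut_morphic/morphicP: Apsi; apply; rewrite inE.
have -> : (phi * psi) @: D = psi @: (phi @: D).
  by rewrite -imset_comp; apply: eq_imset => x; rewrite /= permM.
have -> : psi @: (phi @: D) = psi a *: (psi @: D).
  rewrite phiD -!lcosetE /lcoset -!imset_comp.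
  by apply: eq_imset => x /=; rewrite psiM.
by rewrite psiD -mulg_set1 mulgA.
Qed.

Canonical Mult : {group {perm gT}} := Group mult_group_set.

End Multipliers.

(* Indices range over 'I_v = {0, ..., v-1} and coordinates over 'I_n. *)
Notation cube n v := {ffun {ffun 'I_n -> 'I_v} -> bool}.

(* (S_v)^n and G^m with the componentwise group law provided by gproduct. *)
Notation perm_power n v := {dffun forall _ : 'I_n, 'S_v}.
Notation group_power gT m := {dffun forall _ : 'I_m, gT}.

Section Autotopy.

Variables n v : nat.

Definition isotope (C : cube n v) (alpha : perm_power n v) : cube n v :=
  [ffun i : {ffun 'I_n -> 'I_v} => C [ffun j => (alpha j)^-1 (i j)]].

Lemma isotope1 : isotope^~ 1 =1 id.
Proof.
move=> C; apply/ffunP=> i; rewrite ffunE; congr (C _).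
by apply/ffunP=> j; rewrite !ffunE invg1 perm1.
Qed.

Lemma isotopeM C alpha beta :
  isotope C (alpha * beta) = isotope (isotope C alpha) beta.
Proof.
apply/ffunP=> i; rewrite !ffunE; congr (C _).
by apply/ffunP=> j; rewrite !ffunE invMg permM.
Qed.

(* A right action here, because permM composes permutations left to right. *)
Canonical isotopy_action := TotalAction isotope1 isotopeM.

Definition Atop (C : cube n v) : {group perm_power n v} :=
  'C[C | isotopy_action]%G.

End Autotopy.

Definition difference_cube (gT : finGroupType) (n v : nat) (g : 'I_v -> gT)
    (D : {set gT}) : cube n v :=
  [ffun i : {ffun 'I_n -> 'I_v} => \prod_(j < n) g (i j) \in D].

(* Main.v *)
(* If [phi @: D = t phi *: D] then [x_1 |-> (t phi)^-1 * phi x_1] and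
   [x_j |-> phi x_j] for [j > 1] is an autotopy, and so is
   [x_j |-> h_(j-1)^-1 * x_j * h_j] with [h_0 = h_n = 1]. These generate the
   semidirect product provided that [t (phi * psi) = psi (t phi) * t psi], which
   holds as soon as [D] has trivial stabiliser under left translation.

   For a difference set with [k <> lambda] the stabiliser is trivial: the left
   correlations [L a] = #{y in D | a y in D} and the right correlations
   [R x] = #{y in D | y x in D} have the same sum, the same sum of squares and
   the same value at [1], so if [R] is constant off [1] then [L] takes the same
   constant value [lambda] there, whereas [a *: D = D] means [L a = k]. If
   [k = lambda], then [D] is empty or the whole group and [t = 1] works. *)
Require Import Defs.
From mathcomp Require Import all_boot all_fingroup all_algebra.
Import GRing.Theory Num.Theory.

Set Implicit Arguments.
Unset Strict Implicit.
Unset Printing Implicit Defensive.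

(** * Left and right correlations of a subset *)

Section Correlations.

Variables (gT : finGroupType) (D : {set gT}).

Local Open Scope ring_scope.

Definition indicator (x : gT) : int := (x \in D)%:R.

Definition right_corr (x : gT) : int :=
  \sum_y indicator y * indicator (y * x)%g.

Definition left_corr (x : gT) : int :=
  \sum_y indicator y * indicator (x * y)%g.

Lemma corr1 : left_corr 1%g = right_corr 1%g.
Proof. by apply: eq_bigr => y _; rewrite mul1g mulg1. Qed.

Lemma sum_indicator_mulr (y : gT) :
  \sum_x indicator (x * y)%g = \sum_x indicator x.
Proof. by rewrite [RHS](reindex_inj (mulIg y)). Qed.

Lemma sum_indicator_mull (y : gT) :
  \sum_x indicator (y * x)%g = \sum_x indicator x.
Proof. by rewrite [RHS](reindex_inj (mulgI y)). Qed.

Lemma sum_corr : \sum_x left_corr x = \sum_x right_corr x.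
Proof.
rewrite exchange_big [RHS]exchange_big; apply: eq_bigr => y _ /=.
by rewrite -!mulr_sumr sum_indicator_mulr sum_indicator_mull.
Qed.

(** For fixed [y] and [z], substituting [x * y] for the variable turns the sum over [x] into
    [right_corr (y^-1 * z)]; grouping the pairs by [y^-1 * z] then yields the second factor
    [right_corr]. *)
Lemma sum_corr_sqr : \sum_x left_corr x ^+ 2 = \sum_x right_corr x ^+ 2.
Proof.
transitivity (\sum_y \sum_z indicator y * indicator z *
                right_corr (y^-1 * z)%g).
  under eq_bigr => x _ do rewrite expr2 big_distrlr /=.
  rewrite exchange_big; apply: eq_bigr => y _ /=.
  rewrite exchange_big; apply: eq_bigr => z _ /=.
  rewrite mulr_sumr [RHS](reindex_inj (mulIg y)); apply: eq_bigr => x _ /=.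
  by rewrite -!mulgA mulKVg mulrACA.
transitivity (\sum_y \sum_x indicator y * indicator (y * x)%g * right_corr x).
  apply: eq_bigr => y _; rewrite (reindex_inj (mulgI y)) /=.
  by apply: eq_bigr => x _; rewrite mulKg.
by rewrite exchange_big; apply: eq_bigr => x _; rewrite -mulr_suml expr2.
Qed.

(** The total squared deviation from [c] depends only on sums shared by both correlations. The terms
    at [1] cancel, and the rest is zero on the right, so each left square vanishes. *)
Lemma left_corr_const (c : int) :
    (forall x, x != 1%g -> right_corr x = c) ->
  forall x, x != 1%g -> left_corr x = c.
Proof.
move=> rc x x_n1; apply/eqP; rewrite -subr_eq0 -sqrf_eq0; apply/eqP.
have sumB (F : gT -> int) : \sum_y (F y - c) ^+ 2 =
    \sum_y F y ^+ 2 - 2 * c * (\sum_y F y) + \sum_(y : gT) c ^+ 2.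
  rewrite mulr_sumr -sumrB -big_split /=; apply: eq_bigr => y _.
  by rewrite sqrrB -mulr_natl [F y * c]mulrC mulrA.
have: \sum_y (left_corr y - c) ^+ 2 = \sum_y (right_corr y - c) ^+ 2.
  by rewrite !sumB sum_corr sum_corr_sqr.
rewrite (bigD1 1%g) // [RHS](bigD1 1%g) //= corr1 => /addrI.
rewrite [RHS]big1 => [|y y_n1]; last by rewrite rc // subrr expr0n.
by move/psumr_eq0P=> -> // y _; apply: sqr_ge0.
Qed.

Lemma right_corr_card (x : gT) :
  right_corr x = #|[set d in setX D D | (d.1^-1 * d.2)%g == x]|%:R.
Proof.
transitivity (#|[set y in D | (y * x)%g \in D]|%:R : int).
  rewrite -sum1_card natr_sum big_mkcond; apply: eq_bigr => y _.
  by rewrite inE /indicator; case: (y \in D); case: (_ \in D).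
rewrite -(card_imset _ (f := fun y => (y, y * x)%g)) => [|y z [] //].
congr (_%:R); apply: eq_card => -[y z]; rewrite !inE /=.
apply/imsetP/idP => [[u /[!inE] /andP[uD uxD] [-> ->]]|].
  by rewrite uD uxD mulKg /=.
case/andP=> /andP[yD zD] /eqP <-.
by exists y; rewrite ?inE mulKVg ?yD.
Qed.

End Correlations.

(** * Multipliers as homomorphisms *)

Section Multiplier.

Local Open Scope group_scope.

Variables (gT : finGroupType) (D : {set gT}).

Lemma MultM : {in Mult D, forall phi : {perm gT}, {morph phi : x y / x * y}}.
Proof.
move=> phi /mult_setP[/Aut_morphic/morphicP phiM _] x y.
by rewrite phiM ?inE.
Qed.

Lemma Mult1 : {in Mult D, forall phi : {perm gT}, phi 1 = 1}.
Proof.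
by move=> phi /MultM phiM; apply: (mulgI (phi 1)); rewrite -phiM !mulg1.
Qed.

Lemma MultV : {in Mult D, forall phi : {perm gT}, {morph phi : x / x^-1}}.
Proof.
move=> phi Mphi x; apply: (mulgI (phi x)).
by rewrite -MultM // !mulgV Mult1.
Qed.

End Multiplier.

(** * Stabilisers of translates and the cocycle *)

Section Translates.

Local Open Scope group_scope.

Variables (gT : finGroupType) (v k lambda : nat) (D : {set gT}).
Hypothesis D_diff : is_difference_set v k lambda D.

(** A nontrivial stabiliser makes [D] closed under all right multiplications, hence empty or the
    whole group. *)
Lemma lcoset_stab_trivial (s : gT) :
  s != 1 -> s *: D = D -> forall a, a *: D = D.
Proof.
case: D_diff => _ _ Dl s_n1 sD.
have rc x : x != 1 -> right_corr D x = (lambda%:R)%R.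
  by move=> x_n1; rewrite right_corr_card Dl.
have sy y : (s * y \in D) = (y \in D) by rewrite -[in LHS]sD mem_lcoset mulKg.
have lam : right_corr D 1 = (lambda%:R)%R.
  rewrite -(left_corr_const rc s_n1); apply: eq_bigr => y _.
  by rewrite /indicator sy mulg1.
(* [right_corr D 1 - right_corr D x] is a vanishing sum of nonnegative terms, so its term at [y] is
   zero. *)
have DM x y : y \in D -> y * x \in D.
  move=> yD; have [-> | x_n1] := eqVneq x 1; first by rewrite mulg1.
  have ge0 i : true -> (0 <= indicator D i * indicator D (i * 1)
      - indicator D i * indicator D (i * x))%R.
    by rewrite /indicator mulg1; case: (i \in D); case: (_ \in D).
  have /psumr_eq0P-/(_ ge0 y isT) : (\sum_i (indicator D i * indicator D (i * 1)
      - indicator D i * indicator D (i * x)) = 0)%R.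
    by rewrite sumrB -/(right_corr D 1) -/(right_corr D x) lam rc // subrr.
  by rewrite /indicator mulg1 yD; case: (_ \in D).
move=> a; apply/setP=> x; rewrite mem_lcoset.
have DT y z : y \in D -> z \in D by rewrite -[z](mulKVg y); apply: DM.
by apply/idP/idP; apply: DT.
Qed.

Lemma exists_translation_cocycle :
  exists t : {perm gT} -> gT,
    {in Mult D, forall phi : {perm gT}, phi @: D = t phi *: D} /\
    {in Mult D &, forall phi psi : {perm gT},
       t (phi * psi) = psi (t phi) * t psi}.
Proof.
case: (boolP [forall a : gT, a *: D == D]) => [/forallP triv | ntriv].
  (* Every translate equals [D], so the constant choice [1] is a valid cocycle. *)
  exists (fun=> 1); split=> [phi /mult_setP[_ [a ->]] | phi psi _].
    by rewrite mul1g; apply/eqP.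
  by move/Mult1=> ->; rewrite mulg1.
pose t (phi : {perm gT}) := odflt 1 [pick a : gT | phi @: D == a *: D].
have tP : {in Mult D, forall phi : {perm gT}, phi @: D = t phi *: D}.
  move=> phi /mult_setP[_ [a phiD]]; rewrite /t.
  by case: pickP => [b /eqP // | /(_ a)]; rewrite phiD eqxx.
exists t; split=> // phi psi Mphi Mpsi.
have tD : t (phi * psi) *: D = (psi (t phi) * t psi) *: D.
  rewrite -tP ?groupM //.
  have -> : (phi * psi) @: D = psi @: (phi @: D).
    by rewrite -imset_comp; apply: eq_imset => x; rewrite /= permM.
  rewrite (tP phi) // -mulg_set1 -mulgA -(tP psi) //.
  rewrite -!lcosetE /lcoset -!imset_comp.
  by apply: eq_imset => x /=; rewrite (MultM Mpsi).
(* Both sides translate [D] to the same set; were they distinct, their quotient would be a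
   nontrivial stabiliser. *)
apply/eqP; rewrite eq_mulgV1; apply: contraR ntriv => ne.
apply/forallP=> a; apply/eqP.
apply: (@lcoset_stab_trivial ((psi (t phi) * t psi)^-1 * t (phi * psi))).
  by rewrite -eq_mulVg1 eq_sym eq_mulgV1.
by rewrite -mulg_set1 -mulgA tD mulgA mulg_set1 mulVg mul1g.
Qed.

End Translates.

(** * Automorphisms acting on a direct power *)

Section ComponentwiseAction.

Local Open Scope group_scope.

Variables (gT : finGroupType) (m : nat) (A : {group {perm gT}}).
Hypothesis sAAut : A \subset Aut [set: gT].

Definition power_act (h : group_power gT m) (phi : {perm gT}) :
  group_power gT m := [ffun i => phi (h i)].

Lemma power_act_is_action : is_action A power_act.
Proof.
split=> [phi h h' /ffunP eq_h | h phi psi _ _]; apply/ffunP=> i.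
  by have:= eq_h i; rewrite !ffunE => /perm_inj.
by rewrite !ffunE permM.
Qed.

Definition power_action : action A (group_power gT m) :=
  Action power_act_is_action.

Lemma power_action_is_group :
  is_groupAction [set: group_power gT m] power_action.
Proof.
move=> phi Aphi; rewrite inE; apply/andP; split.
  by apply/subsetP=> h; rewrite inE.
have/Aut_morphic/morphicP phiM := subsetP sAAut _ Aphi.
apply/morphicP=> h h' _ _; apply/ffunP=> i.
by rewrite !actpermE !ffunE phiM ?inE.
Qed.

Definition power_groupAction : groupAction A [set: group_power gT m] :=
  GroupAction power_action_is_group.

End ComponentwiseAction.

(** * Embedding pairs as autotopies *)

Section Embedding.

Local Open Scope group_scope.

Variables (n : nat) (gT : finGroupType) (v : nat).
Hypothesis n_ge2 : (2 <= n)%N.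
Variables (g : 'I_v -> gT) (g' : gT -> 'I_v).
Hypotheses (gK : cancel g g') (g'K : cancel g' g).
Variables (D : {set gT}) (t : {perm gT} -> gT).
Hypothesis tD : {in Mult D, forall phi : {perm gT}, phi @: D = t phi *: D}.
Hypothesis tM : {in Mult D &, forall phi psi : {perm gT},
  t (phi * psi) = psi (t phi) * t psi}.

(* The sequence [t phi, h_1, ..., h_(n-1), 1, 1, ...]; the pair [(phi, h)] acts
   on coordinate [j] by [x |-> (twist j)^-1 * phi x * twist (j+1)], so that the
   intermediate terms cancel in the product of all coordinates. *)
Definition twist (phi : {perm gT}) (h : group_power gT n.-1) (j : nat) : gT :=
  if j is i.+1 then oapp h 1 (insub i) else t phi.

Lemma twistS phi h (i : 'I_n.-1) : twist phi h i.+1 = h i.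
Proof. by rewrite /= valK. Qed.

Lemma twist_last phi h : twist phi h n = 1.
Proof.
by rewrite -[X in twist _ _ X](prednK (ltnW n_ge2)) /= insubF ?ltnn.
Qed.

Lemma twistM phi psi h h' j : phi \in Mult D -> psi \in Mult D ->
  twist (phi * psi) (power_act h psi * h') j
    = psi (twist phi h j) * twist psi h' j.
Proof.
move=> Mphi Mpsi; case: j => [|i] /=; first exact: tM.
by case: insubP => [u _ _|_] /=; rewrite ?ffunE // (Mult1 Mpsi) mulg1.
Qed.

Definition coord_fun phi h j (x : 'I_v) : 'I_v :=
  g' ((twist phi h j)^-1 * phi (g x) * twist phi h j.+1).

Lemma coord_fun_inj phi h j : injective (coord_fun phi h j).
Proof.
move=> x y /(can_inj g'K)/mulIg/mulgI/perm_inj.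
exact: (can_inj gK).
Qed.

Definition embed_pair phi h : perm_power n v :=
  [ffun j : 'I_n => perm (@coord_fun_inj phi h j)].

Lemma embed_pairE phi h (j : 'I_n) x :
  g (embed_pair phi h j x)
    = (twist phi h j)^-1 * phi (g x) * twist phi h j.+1.
Proof. by rewrite ffunE permE g'K. Qed.

Lemma embed_pairM phi psi h h' : phi \in Mult D -> psi \in Mult D ->
  embed_pair (phi * psi) (power_act h psi * h')
    = embed_pair phi h * embed_pair psi h'.
Proof.
move=> Mphi Mpsi; apply/ffunP=> j; apply/permP=> x; apply: (can_inj gK).
rewrite embed_pairE (dffunM j) !permM !embed_pairE !twistM //.
by rewrite !(MultM Mpsi) (MultV Mpsi) invMg !mulgA.
Qed.

(** Evaluating each coordinate at [1] shows that consecutive twists agree; the last one is [1], so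
    all are, and only [phi] remains. *)
Lemma embed_pair_eq1 phi h :
  phi \in Mult D -> embed_pair phi h = 1 -> phi = 1 /\ h = 1.
Proof.
move=> Mphi eq1.
have fix_x (j : 'I_n) y :
    (twist phi h j)^-1 * phi y * twist phi h j.+1 = y.
  by rewrite -{1}[y]g'K -embed_pairE eq1 ffunE perm1 g'K.
have twist_step (j : 'I_n) : twist phi h j.+1 = twist phi h j.
  have:= fix_x j 1; rewrite (Mult1 Mphi) mulg1 => /eqP.
  by rewrite -eq_mulVg1 => /eqP.
(* Descending induction, starting from [twist_last]. *)
have twist1 j : (j <= n)%N -> twist phi h (n - j) = 1.
  elim: j => [|j IHj] jn; first by rewrite subn0 twist_last.
  have jlt : (n - j.+1 < n)%N by rewrite ltn_subrL (ltnW n_ge2).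
  rewrite -(twist_step (Ordinal jlt)) /= -/(twist phi h (n - j.+1).+1).
  by rewrite -subSn // subSS IHj // ltnW.
have{} twist1 j : (j <= n)%N -> twist phi h j = 1.
  by move=> jn; rewrite -(subKn jn) twist1 // leq_subr.
split.
  apply/permP=> y; rewrite perm1 -[RHS](fix_x (Ordinal (ltnW n_ge2))).
  by rewrite !twist1 ?(ltnW n_ge2) // invg1 mul1g mulg1.
apply/ffunP=> i; rewrite ffunE -(twistS phi) twist1 //.
exact: leq_trans (ltn_ord i) (leq_pred n).
Qed.

Lemma prod_telescope (y z : nat -> gT) (m : nat) :
  \prod_(j < m) ((z j)^-1 * y j * z j.+1)
    = (z 0)^-1 * (\prod_(j < m) y j) * z m.
Proof.
elim: m => [|m IHm]; first by rewrite !big_ord0 mulg1 mulVg.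
by rewrite !big_ord_recr /= IHm -!mulgA mulKVg.
Qed.

Lemma embed_pair_Atop phi h :
  phi \in Mult D -> embed_pair phi h \in Atop (difference_cube n g D).
Proof.
move=> Mphi; apply/astab1P; apply/ffunP=> i; rewrite !ffunE /=.
set alpha := embed_pair phi h.
pose x (j : 'I_n) := (alpha j)^-1 (i j).
have prod_i : \prod_(j < n) g (i j) = (t phi)^-1 * phi (\prod_(j < n) g (x j)).
  have phi_prod : phi (\prod_(j < n) g (x j)) = \prod_(j < n) phi (g (x j)).
    exact: (big_morph phi (MultM Mphi) (Mult1 Mphi)).
  (* Extends the factors to all of [nat] for [prod_telescope]; the default [1] is never reached
     below [n]. *)
  pose y (j : nat) := oapp (fun u : 'I_n => phi (g (x u))) 1 (insub j).
  have yE (j : 'I_n) : y j = phi (g (x j)) by rewrite /y valK.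
  transitivity ((twist phi h 0)^-1 * (\prod_(j < n) y j) * twist phi h n).
    rewrite -prod_telescope; apply: eq_bigr => j _.
    by rewrite yE -embed_pairE permKV.
  by rewrite twist_last mulg1 phi_prod; congr (_ * _); apply: eq_bigr.
rewrite prod_i -mem_lcoset -tD // mem_imset; last exact: perm_inj.
by congr (_ \in D); apply: eq_bigr => j _; rewrite ffunE.
Qed.

End Embedding.

Theorem theorem3p4 (n : nat) (n_ge2 : (2 <= n)%N)
    (gT : finGroupType) (v k lambda : nat)
    (g : 'I_v -> gT) (g_bij : bijective g)
    (D : {set gT}) (D_diff : is_difference_set v k lambda D) :
  exists (to : groupAction (Mult D) [set: group_power gT n.-1])
         (H : {group perm_power n v}),
    H \subset Atop (difference_cube n g D) /\
    H \isog [set: sdprod_by to].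
Proof.
have [g' gK g'K] := g_bij.
have [t [tD tM]] := exists_translation_cocycle D_diff.
have sMAut : Mult D \subset Aut [set: gT].
  by apply/subsetP=> phi /mult_setP[].
pose to := power_groupAction n.-1 sMAut; exists to.
have inM (u : sdprod_by to) : (u.1 \in Mult D)%g.
  by case: u => -[phi h] /= /setXP[].
pose f (u : sdprod_by to) := embed_pair (n := n) gK g'K t u.1 u.2.
have fM : {in [set: sdprod_by to] &, {morph f : u w / (u * w)%g}}.
  (* The product in [sdprod_by to] is by definition the pair on the left of [embed_pairM]. *)
  by move=> u w _ _; rewrite /f -(embed_pairM gK g'K tM) ?inM.
pose fm := Morphism fM.
exists (fm @* [set: sdprod_by to])%G; split.
  apply/subsetP=> _ /morphimP[u _ _ ->] /=.
  exact: (embed_pair_Atop n_ge2 gK g'K tD _ (inM u)).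
rewrite isog_sym; apply/sub_isog => //.
apply/subsetP=> u /morphpreP[_ /set1P fu1]; apply/set1P.
have [u1 u2] := embed_pair_eq1 n_ge2 (inM u) fu1.
by apply: val_inj; rewrite /= [LHS]surjective_pairing u1 u2.
Qed.
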